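(* Let $\gamma\ge 1$, let $\Omega=\{(x_1,x_2)\in\mathbb{R}^2 : 0<x_1<1,\ 0<x_2<x_1^\gamma\}$ and, for $i\ge 0$, let $\Omega_i=\{(x_1,x_2)\in\Omega : 2^{-(i+2)}<x_1<2^{-i}\}$. Let $1<p,q<\infty$ with $\frac1p+\frac1q=1$. Let $\omega:\Omega\to\mathbb{R}$, $\omega(x)=\omega(x_1)$, be a weight depending only on the first coordinate, admissible for $p$ with constant $C_\omega$, and such that, with $\omega_i:=\omega(2^{-i})$, there is a constant $C_H$ for which $$\sum_{j=1}^\infty |\Omega_j|\,\omega_j^{p}\Big(\sum_{i=1}^j d_i\Big)^p\le C_H^p\sum_{j=1}^\infty |\Omega_j|\,\omega_j^{p}\,d_j^p$$ holds for every non-negative sequence $\{d_j\}_{j\ge 1}$. Then there is a constant $C_d$ such that, given $g\in L^1(\Omega)$ with $\int_\Omega g=0$, there exists a $\mathcal{C}$-orthogonal decomposition $\{g_i\}_{i\ge 0}$ of $g$ subordinate to $\{\Omega_i\}_{i\ge 0}$ such that $$\sum_{i=0}^\infty\int_{\Omega_i}|g_i(x)|^q\,\omega^{-q}(x)\,dx\le C_d^q\int_\Omega |g(x)|^q\,\omega^{-q}(x)\,dx .$$ Moreover, the optimal constant $C_d$ satisfies $C_d\le 2^{2+1/q}\,C_\omega^2\,C_H$.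
   Context: A weight on $\Omega$ is a positive Lebesgue-measurable function $\Omega\to\mathbb{R}$. A weight $\omega$ on $\Omega$ is called admissible (for $p$) with constant $C_\omega$ if $\omega^p\in L^1(\Omega)$ and $\operatorname{ess\,sup}_{x\in\Omega_i}\omega(x)\le C_\omega\operatorname{ess\,inf}_{x\in\Omega_i}\omega(x)$ for all $i\ge 0$, with $C_\omega$ independent of $i$. For a weight depending only on $x_1$ one writes $\omega(x)=\omega(x_1)$, so $\omega(2^{-i})$ is its value at $x_1=2^{-i}$. $|\Omega_i|$ denotes Lebesgue measure. Given an integrable function $g:\Omega\to\mathbb{R}$ with $\int_\Omega g=0$, a $\mathcal{C}$-orthogonal decomposition of $g$ subordinate to $\{\Omega_i\}_{i\ge 0}$ is a collection of integrable functions $\{g_i\}_{i\ge 0}$ such that: (1) $g(x)=\sum_{i\ge 0}g_i(x)$; (2) $\operatorname{supp}(g_i)\subset\Omega_i$ for all $i\ge 0$; (3) $\int_{\Omega_i}g_i=0$ for all $i\ge 0$. (Here $\mathcal{C}$ refers to the space of constant functions.)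
   Formalization: The formal theorem also assumes that, for i ≥ 1, ω(2^{-i}) lies between the essential infimum and essential supremum of ω on Ω_{i-1}; without this, values on null fibres could make the Hardy hypothesis unrelated to ω and the claim false. *)

(* Defs.v *)
From HB Require Import structures.
From mathcomp Require Import all_boot all_order all_algebra.
From mathcomp Require Import all_classical all_reals all_analysis.
From mathcomp Require Import measurable_realfun ess_sup_inf.

Set Implicit Arguments.
Unset Strict Implicit.
Unset Printing Implicit Defensive.

Import Order.TTheory GRing.Theory Num.Theory.
Import numFieldNormedType.Exports.

Local Open Scope classical_set_scope.
Local Open Scope ring_scope.

Section Plane.
Variable R : realType.

Definition borel_plane_measure :
    {measure set (measurableTypeR R * measurableTypeR R)%type -> \bar R} :=
  (@lebesgue_measure R \x @lebesgue_measure R)%E.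

(* R^2 with the sigma-algebra of Lebesgue measurable sets, i.e. the completion
   of the Borel sigma-algebra (as [completed_lebesgue_measure] on the line);
   on this type [measurable_fun] and [integrable] are meant in the sense of
   Lebesgue. *)
Definition plane := caratheodory_type (borel_plane_measure^*)%mu.

Definition plane_measure : {measure set plane -> \bar R} :=
  @completed_measure_extension _ _ _ borel_plane_measure.

End Plane.

Section Cusp.
Context {R : realType}.
Variable gamma : R.
Local Notation mu := (@plane_measure R).

Definition cusp : set (plane R) :=
  [set x | 0 < x.1 < 1 /\ 0 < x.2 < x.1 `^ gamma].

Definition cusp_piece (i : nat) : set (plane R) :=
  cusp `&` [set x | 2 ^- (i + 2) < x.1 < 2 ^- i].

Lemma measurable_cusp_piece i : measurable (cusp_piece i).
Proof.
apply: caratheodory_measurable_mu_ext.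
pose T := (measurableTypeR R * measurableTypeR R)%type.
have mlt (f h : T -> R) : measurable_fun setT f -> measurable_fun setT h ->
    measurable [set x | f x < h x].
  move=> mf mh; rewrite -[X in measurable X]setTI.
  by apply: (measurable_fun_ltr mf mh measurableT (_ : measurable [set true])).
have m1 : measurable_fun [set: T] fst := measurable_fst.
have m2 : measurable_fun [set: T] snd := measurable_snd.
have mp : measurable_fun [set: T] (fun x => x.1 `^ gamma).
  exact: (@measurableT_comp _ _ _ _ _ _ (@powR R ^~ gamma)).
rewrite (_ : cusp_piece i =
    [set x : T | 0 < x.1] `&` [set x : T | x.1 < 1] `&`
    [set x : T | 0 < x.2] `&` [set x : T | x.2 < x.1 `^ gamma] `&`
    [set x : T | 2 ^- (i + 2) < x.1] `&` [set x : T | x.1 < 2 ^- i]).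
  by do !apply: measurableI; apply: mlt => //; exact: measurable_cst.
apply/seteqP; split => x /=; rewrite /cusp_piece /cusp /=.
  by move=> [[/andP[? ?] /andP[? ?]] /andP[? ?]].
by move=> [[[[[? ?] ?] ?] ?] ?]; split; [split|]; apply/andP.
Qed.

Definition weight (omega : plane R -> R) : Prop :=
  measurable_fun cusp omega /\ forall x, cusp x -> 0 < omega x.

Definition ess_sup_piece (i : nat) (omega : plane R -> R) : \bar R :=
  ess_sup (mrestr mu (measurable_cusp_piece i)) (EFin \o omega).

Definition ess_inf_piece (i : nat) (omega : plane R -> R) : \bar R :=
  ess_inf (mrestr mu (measurable_cusp_piece i)) (EFin \o omega).

Definition admissible (p Comega : R) (omega : plane R -> R) : Prop :=
  mu.-integrable cusp (EFin \o (fun x => omega x `^ p)) /\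
  forall i, (ess_sup_piece i omega <= Comega%:E * ess_inf_piece i omega)%E.

(* The fibre x_1 = 2^-(i+1) of Omega_i is a null set, so admissibility says
   nothing about the value of the weight there. For this value to depend on the
   weight and not on the choice of a representative, it must lie between the
   essential bounds of the weight on Omega_i; this holds for instance for any
   value between the lower and upper limits of w at 2^-(i+1). *)
Definition essential_dyadic_values (w : R -> R) (omega : plane R -> R) : Prop :=
  forall i, (ess_inf_piece i omega <= (w (2 ^- i.+1))%:E
             <= ess_sup_piece i omega)%E.

Definition hardy_inequality (p CH : R) (omega_ : nat -> R) : Prop :=
  forall d : nat -> R, (forall j, (1 <= j)%N -> 0 <= d j) ->
  (\sum_(1 <= j <oo) (mu (cusp_piece j) *
     (omega_ j `^ p * (\sum_(1 <= i < j.+1) d i) `^ p)%:E)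
   <= (CH `^ p)%:E *
      \sum_(1 <= j <oo) (mu (cusp_piece j) * (omega_ j `^ p * d j `^ p)%:E))%E.

(* The support of g_i is the set where g_i does not vanish, without closure. *)
Definition C_orthogonal_decomposition (g : plane R -> R)
    (g_ : nat -> plane R -> R) : Prop :=
  [/\ forall i, mu.-integrable cusp (EFin \o g_ i),
      forall x, cusp x -> series (fun i => g_ i x) @ \oo --> g x,
      forall i, [set x | g_ i x != 0] `<=` cusp_piece i &
      forall i, (\int[mu]_(x in cusp_piece i) (g_ i x)%:E = 0)%E].

Definition decomposition_constant (q : R) (omega : plane R -> R) (Cd : R) :
    Prop :=
  0 <= Cd /\
  forall g : plane R -> R, mu.-integrable cusp (EFin \o g) ->
    (\int[mu]_(x in cusp) (g x)%:E = 0)%E ->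
  exists2 g_ : nat -> plane R -> R, C_orthogonal_decomposition g g_ &
    (\sum_(0 <= i <oo)
       \int[mu]_(x in cusp_piece i) (`|g_ i x| `^ q * omega x `^ (- q))%:E
     <= (Cd `^ q)%:E *
        \int[mu]_(x in cusp) (`|g x| `^ q * omega x `^ (- q))%:E)%E.

Definition optimal_decomposition_constant (q : R) (omega : plane R -> R) : R :=
  inf [set Cd | decomposition_constant q omega Cd].

End Cusp.

(* Main.v *)
(* Cut the cusp into the disjoint slices D_k = {2^-(k+1) <= x_1 < 2^-k}, let B_k
   be the interior of D_k, which is Omega_k /\ Omega_(k-1), and let
   A_k = sum_(j >= k) int_{D_j} g be the mass carried by the tip. Transporting
   A_k across B_k from Omega_k to Omega_(k-1) gives
     g_k = g 1_{D_k} - (A_k / |B_k|) 1_{B_k} + (A_(k+1) / |B_(k+1)|) 1_{B_(k+1)},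
   whose partial sums telescope. Since |Omega_k| <= 2 |B_k| and omega is
   comparable to omega_k on B_k, the energy of the transport terms is controlled
   by sum_k |Omega_k|^(1-q) omega_k^(-q) a_k^q with a_k = int over the tail of
   |g|, and this sum is controlled by the dual of the Hardy inequality. The
   duality is carried out inside the integral: with
   d_k = |Omega_k|^(1-q) omega_k^(-q) a_k^(q-1) and S = sum_k d_k 1_{tail k},
   the sum is int |g| S, to which Young's inequality
     |g| S <= t^q |g|^q omega^-q / q + t^-p S^p omega^p / p,  t = C_omega C_H,
   applies pointwise; the Hardy inequality absorbs the last term. *)
Require Import Defs.
From mathcomp Require Import all_boot all_order all_algebra.
From mathcomp Require Import all_classical all_reals all_analysis.
From mathcomp Require Import measurable_realfun ess_sup_inf.
From mathcomp Require Import ring lra.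

Set Implicit Arguments.
Unset Strict Implicit.
Unset Printing Implicit Defensive.

Import Order.TTheory GRing.Theory Num.Theory.
Import numFieldNormedType.Exports.

Local Open Scope classical_set_scope.
Local Open Scope ring_scope.

(** * Integrals against indicator functions, and a power inequality *)

Lemma integral_mul_indic d (T : measurableType d) (R : realType)
    (mu : {measure set T -> \bar R}) (X A : set T) (f : T -> R) :
  measurable X -> measurable A -> A `<=` X ->
  (\int[mu]_(x in X) (f x * \1_A x)%:E = \int[mu]_(x in A) (f x)%:E)%E.
Proof.
move=> mX mA AX; rewrite -[in RHS](setIidr AX) integral_mkcondr.
apply: eq_integral => x _; rewrite patchE indicE.
by case: (x \in A); rewrite ?mulr1 ?mulr0.
Qed.

Lemma integrable_mul_indic d (T : measurableType d) (R : realType)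
    (mu : {measure set T -> \bar R}) (X A : set T) (f : T -> R) :
  measurable X -> measurable A -> A `<=` X -> mu.-integrable A (EFin \o f) ->
  mu.-integrable X (fun x => (f x * \1_A x)%:E).
Proof.
move=> mX mA AX fi; have /integrable_restrict : mu.-integrable (X `&` A) (EFin \o f).
  by rewrite setIidr.
move=> /(_ mA mX); apply: eq_integrable => // x _.
by rewrite patchE indicE; case: (x \in A); rewrite ?mulr1 ?mulr0.
Qed.

(** By symmetry [|b| <= |a|] may be assumed; then [|a - b| <= 2 |a|], so one of the two terms on the
    right already suffices. *)
Lemma normB_powR_le (R : realType) (a b q : R) : 0 <= q ->
  `|a - b| `^ q <= 2 `^ q * `|a| `^ q + 2 `^ q * `|b| `^ q.
Proof.
move=> q0; wlog ba : a b / `|b| <= `|a|.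
  move=> h; have [|/ltW] := leP `|b| `|a|; first exact: h.
  by move=> ab; rewrite distrC [leRHS]addrC; exact: h.
apply: (@le_trans _ _ ((2 * `|a|) `^ q)).
  rewrite ge0_ler_powR ?nnegrE ?mulr_ge0// (le_trans (ler_normB _ _))//.
  by rewrite mulr_natl mulr2n lerD2l.
by rewrite powRM// lerDl mulr_ge0 ?powR_ge0.
Qed.

(** * Tails of a sequence of sets *)

Section Tails.
Context d (T : measurableType d) (D : nat -> set T).

Definition tail i := \bigcup_(j in [set j | (i <= j)%N]) D j.

Lemma tail_sub i : tail i `<=` \bigcup_k D k.
Proof. by move=> x [j _ Dx]; exists j. Qed.

Lemma tail0 : tail 0 = \bigcup_k D k.
Proof. by apply/seteqP; split=> x [j _ Dx]; exists j. Qed.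

Lemma tailS i : tail i = D i `|` tail i.+1.
Proof.
apply/seteqP; split=> x.
- case=> j /=; rewrite leq_eqVlt => /orP[/eqP <- ?|ij Dx]; first by left.
  by right; exists j.
- by case=> [Dx|[j /= ij Dx]]; [exists i => //= | exists j => //=; exact: ltnW].
Qed.

Lemma measurable_tail i : (forall k, measurable (D k)) -> measurable (tail i).
Proof. by move=> mD; apply: bigcup_measurable. Qed.

Hypothesis tD : trivIset setT D.

Lemma trivIset_index i j x : D i x -> D j x -> i = j.
Proof. by move=> Di Dj; apply: tD => //; exists x. Qed.

Lemma tail_mem i k x : D k x -> (x \in tail i) = (i <= k)%N.
Proof.
move=> Dk; apply/idP/idP; last by move=> ik; rewrite inE; exists k.
by rewrite inE => -[j /= ij Dj]; rewrite (trivIset_index Dk Dj).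
Qed.

Lemma tail_disj i : [disjoint D i & tail i.+1]%classic.
Proof.
apply/disj_setPS => x [Di [j /= ij Dj]].
by move: ij; rewrite (trivIset_index Di Dj) ltnn.
Qed.

End Tails.

(** * The dual Hardy inequality *)

Section DualHardy.
Context d (T : measurableType d) (R : realType).
Context (mu : {measure set T -> \bar R}) (p q : R) (D : nat -> set T).
Context (omega g : T -> R) (w m : nat -> R) (C H : R).
Local Notation X := (\bigcup_k D k).
Local Notation tail := (tail D).
Hypotheses (p1 : 1 < p) (q1 : 1 < q) (pq : p^-1 + q^-1 = 1).
Hypotheses (mD : forall k, measurable (D k)) (tD : trivIset setT D).
Hypotheses (m_gt0 : forall k, 0 < m k).
Hypothesis muD : forall k, (mu (D k) <= (m k)%:E)%E.
Hypotheses (C_gt0 : 0 < C) (H_gt0 : 0 < H).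
Hypotheses (w_gt0 : forall k, (1 <= k)%N -> 0 < w k).
Hypothesis momega : measurable_fun X omega.
Hypothesis omega_gt0 : forall x, X x -> 0 < omega x.
Hypothesis omega_le : forall k, (1 <= k)%N ->
  {ae mu, forall x, D k x -> omega x <= C * w k}.
Hypothesis hardy : forall d : nat -> R, (forall j, (1 <= j)%N -> 0 <= d j) ->
  (\sum_(1 <= j <oo) ((m j)%:E *
     (w j `^ p * (\sum_(1 <= i < j.+1) d i) `^ p)%:E)
   <= (H `^ p)%:E *
      \sum_(1 <= j <oo) ((m j)%:E * (w j `^ p * d j `^ p)%:E))%E.
Hypothesis ig : mu.-integrable X (EFin \o g).

Definition tail_mass i := fine (\int[mu]_(x in tail i) `|g x|%:E)%E.

Let mX : measurable X. Proof. exact: bigcup_measurable. Qed.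

Let mtail i : measurable (tail i). Proof. exact: measurable_tail. Qed.

Let mg : measurable_fun X g.
Proof. by apply/measurable_EFinP; exact: measurable_int ig. Qed.

Let mpow (r : R) (f : T -> R) A :
  measurable_fun A f -> measurable_fun A (fun x => f x `^ r).
Proof. exact: (@measurableT_comp _ _ _ _ _ _ (@powR R ^~ r)). Qed.

Lemma tail_massE i : ((tail_mass i)%:E = \int[mu]_(x in tail i) `|g x|%:E)%E.
Proof.
rewrite /tail_mass fineK//; apply: integrable_fin_num => //.
by apply: integrable_norm; apply: integrableS ig => //; exact: tail_sub.
Qed.

Lemma tail_mass_ge0 i : 0 <= tail_mass i.
Proof. by rewrite fine_ge0// integral_ge0// => x _; rewrite lee_fin. Qed.

(** The sequence d_i tested in the Hardy inequality, cut off after n so that [tail_energy n] is a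
    finite real that can later be absorbed. Index 0 is left out because the Hardy inequality starts
    at 1. *)
Definition test_coef n i := if (1 <= i <= n)%N then
  m i `^ (1 - q) * w i `^ (- q) * tail_mass i `^ (q - 1) else 0.

Definition test_fun n x := \sum_(1 <= i < n.+1) test_coef n i * \1_(tail i) x.

Lemma test_coef_ge0 n i : 0 <= test_coef n i.
Proof. by rewrite /test_coef; case: ifP => // _; rewrite !mulr_ge0 ?powR_ge0. Qed.

Lemma test_fun_ge0 n x : 0 <= test_fun n x.
Proof.
by apply: sumr_ge0 => i _; rewrite mulr_ge0 ?test_coef_ge0// indicE; case: (_ \in _).
Qed.

(** A point of [D k] lies in [tail i] exactly when i <= k. Hence the test function is constant on
    each slice, its value being the partial sum that the Hardy inequality contains. *)
Lemma test_funE n k x : D k x -> test_fun n x = \sum_(1 <= i < k.+1) test_coef n i.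
Proof.
move=> Dk; rewrite /test_fun.
under eq_bigr => i _ do rewrite indicE (tail_mem tD i Dk) mulr_natr mulrb.
(* Both sums are extended to the common range up to n + k and compared term by term; [test_coef n i]
   vanishes for i > n. *)
rewrite -big_mkcond/= (big_nat_widen _ _ (n + k).+1) ?ltnS ?leq_addr//.
rewrite [RHS](big_nat_widen _ _ (n + k).+1) ?ltnS ?leq_addl//.
rewrite big_mkcond [RHS]big_mkcond; apply: eq_bigr => i _ /=.
by rewrite !ltnS /test_coef; case: (i <= k)%N; case: (i <= n)%N; rewrite ?andbF.
Qed.

Definition mass_term i := m i `^ (1 - q) * w i `^ (- q) * tail_mass i `^ q.

Definition tail_energy n := \sum_(1 <= i < n.+1) mass_term i.

Lemma test_coef_mass n i : (1 <= i <= n)%N ->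
  test_coef n i * tail_mass i = mass_term i.
Proof.
move=> iin; rewrite /mass_term /test_coef iin -mulrA [_ * tail_mass i]mulrC.
rewrite mulr_powRB1//; first exact: tail_mass_ge0.
by rewrite (lt_trans ltr01).
Qed.

Let conj_mul : p * (q - 1) = q.
Proof.
have p0 : p != 0 by rewrite gt_eqF// (lt_trans ltr01).
have q0 : q != 0 by rewrite gt_eqF// (lt_trans ltr01).
have : p + q = p * q by rewrite -[RHS]mulr1 -pq; field; rewrite p0 q0.
by move=> pqE; rewrite mulrBr mulr1 -pqE addrAC subrr add0r.
Qed.

(** The exponents in [test_coef] are made for this identity: since p (q - 1) = q, the p-th power of
    d_i, weighted as in the Hardy inequality, is d_i a_i again, and the right-hand side of that
    inequality becomes the tail energy itself. *)
Lemma test_coef_powR n i : (1 <= i <= n)%N ->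
  m i * (w i `^ p * test_coef n i `^ p) = mass_term i.
Proof.
move=> iin; have i1 : (1 <= i)%N by case/andP: iin.
have m0 := m_gt0 i; have w0 := w_gt0 i1.
rewrite /mass_term /test_coef iin !powRM ?mulr_ge0 ?powR_ge0// -!powRrM.
rewrite (mulrC (q - 1)) conj_mul (mulrC _ p) (mulrC _ p).
have -> : m i `^ (1 - q) = m i * m i `^ (p * (1 - q)).
  rewrite -[X in X * _](powRr1 (ltW m0)) -powRD ?(gt_eqF m0) ?implybT//.
  by congr powR; move: conj_mul; lra.
have -> : w i `^ (- q) = w i `^ p * w i `^ (p * - q).
  rewrite -powRD ?(gt_eqF w0) ?implybT//.
  by congr powR; move: conj_mul; lra.
by ring.
Qed.

Let mabsg A : A `<=` X -> measurable_fun A (fun x => `|g x|).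
Proof.
move=> AX; apply: measurableT_comp => //.
exact: measurable_funS mg.
Qed.

Let mtest n A : measurable_fun A (test_fun n).
Proof.
apply: measurable_sum => i; apply: measurable_funM; first exact: measurable_cst.
exact: measurable_indic.
Qed.

Lemma integral_mul_test n :
  (\int[mu]_(x in X) (`|g x| * test_fun n x)%:E = (tail_energy n)%:E)%E.
Proof.
rewrite (eq_integral (fun x => \sum_(i <- index_iota 1 n.+1)
    (test_coef n i * (`|g x| * \1_(tail i) x))%:E)%E); last first.
  move=> x _; rewrite sumEFin mulr_sumr; congr EFin.
  by apply: eq_bigr => i _; ring.
have mgi i : measurable_fun X (fun x => `|g x| * \1_(tail i) x).
  by apply: measurable_funM; [exact: mabsg | exact: measurable_indic].
have gi0 i x : 0 <= `|g x| * \1_(tail i) x.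
  by rewrite mulr_ge0// indicE; case: (_ \in _).
rewrite ge0_integral_sum//; last 2 first.
  by move=> i; apply/measurable_EFinP; apply: measurable_funM.
  by move=> i x _; rewrite lee_fin mulr_ge0 ?test_coef_ge0.
rewrite /tail_energy -sumEFin; apply: eq_big_nat => i; rewrite ltnS => iin.
under eq_integral do rewrite EFinM.
rewrite ge0_integralZl_EFin ?lee_fin ?test_coef_ge0//; last exact/measurable_EFinP.
rewrite integral_mul_indic//; last exact: tail_sub.
by rewrite -tail_massE -EFinM test_coef_mass.
Qed.

(** On [D k] the test function is constant, omega <= C w_k almost everywhere, and the measure is at
    most m_k. *)
Lemma integral_test_piece n k :
  (\int[mu]_(x in D k) ((test_fun n x * omega x) `^ p)%:E <=
  (C `^ p)%:E *
   ((m k)%:E * (w k `^ p * (\sum_(1 <= i < k.+1) test_coef n i) `^ p)%:E))%E.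
Proof.
have p0 : 0 < p by rewrite (lt_trans ltr01).
set s := \sum_(1 <= i < k.+1) _.
have s0 : 0 <= s by apply: sumr_ge0 => i _; exact: test_coef_ge0.
(* No weight bound is available on slice 0; there the test function is an empty sum and the
   integrand vanishes. *)
have [k0|k1] := posnP k.
  rewrite integral0_eq; first by
    rewrite -!EFinM lee_fin !mulr_ge0 ?powR_ge0// ltW.
  by move=> x Dx; rewrite (test_funE _ Dx) k0 big_geq// mul0r powR0// gt_eqF.
have DX : D k `<=` X by move=> x Dx; exists k.
have mo : measurable_fun (D k) omega by exact: measurable_funS momega.
apply: (@le_trans _ _ (\int[mu]_(x in D k) (cst ((C * w k * s) `^ p)%:E) x)%E).
  apply: ae_ge0_le_integral => //.
  - by move=> x _; rewrite lee_fin powR_ge0.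
  - by apply/measurable_EFinP; apply: mpow; exact: measurable_funM.
  - by move=> x _; rewrite lee_fin powR_ge0.
  have := omega_le k1; apply: filterS => x ox Dx.
  rewrite lee_fin (test_funE _ Dx) -/s mulrC ge0_ler_powR ?nnegrE ?(ltW p0)//.
  + by rewrite mulr_ge0// ltW// omega_gt0//; exact: DX.
  + by rewrite !mulr_ge0// ltW// w_gt0.
  + by rewrite ler_wpM2r// ox.
rewrite integral_cst// !powRM ?mulr_ge0 ?(ltW C_gt0) ?(ltW (w_gt0 k1))//.
rewrite [leRHS]muleCA -[X in (_ <= _ * X)%E]EFinM mulrA muleC.
by rewrite lee_wpmul2r// lee_fin !mulr_ge0 ?powR_ge0.
Qed.

Lemma integral_test_powR n :
  (\int[mu]_(x in X) ((test_fun n x * omega x) `^ p)%:E <=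
  ((C * H) `^ p * tail_energy n)%:E)%E.
Proof.
have p0 : 0 < p by rewrite (lt_trans ltr01).
rewrite ge0_integral_bigcup//; last 2 first.
  by apply/measurable_EFinP; apply: mpow; exact: measurable_funM.
  by move=> x _; rewrite lee_fin powR_ge0.
rewrite nneseries_recl//; last first.
  by move=> k _; apply: integral_ge0 => x _; rewrite lee_fin powR_ge0.
rewrite integral0_eq ?add0e; last first.
  by move=> x Dx; rewrite (test_funE _ Dx) big_geq// mul0r powR0// gt_eqF.
apply: (@le_trans _ _ (\sum_(1 <= k <oo) ((C `^ p)%:E *
   ((m k)%:E * (w k `^ p * (\sum_(1 <= i < k.+1) test_coef n i) `^ p)%:E)))%E).
  apply: lee_nneseries => [k _ _|k _]; last exact: integral_test_piece.
  by apply: integral_ge0 => x _; rewrite lee_fin powR_ge0.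
rewrite nneseriesZl; last first.
  by move=> k _; rewrite -EFinM lee_fin !mulr_ge0 ?powR_ge0// ltW.
apply: (@le_trans _ _ ((C `^ p)%:E * ((H `^ p)%:E * (tail_energy n)%:E))%E);
  last first.
  by rewrite -!EFinM mulrA powRM// ltW.
rewrite lee_wpmul2l ?lee_fin ?powR_ge0//.
apply: (le_trans (hardy _)) => [j _|]; first exact: test_coef_ge0.
rewrite lee_wpmul2l ?lee_fin ?powR_ge0// (nneseries_split _ n); last first.
  by move=> k _; rewrite -EFinM lee_fin !mulr_ge0 ?powR_ge0// ltW.
(* Beyond n the test coefficients vanish, so the right-hand series reduces to the finite sum
   [tail_energy n]. *)
rewrite [X in (_ + X)%E]eseries0 ?adde0; last first.
  move=> k; rewrite add1n => nk _; rewrite /test_coef (leqNgt k n) nk andbF.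
  by rewrite powR0 ?gt_eqF// mulr0 mule0.
rewrite add1n /tail_energy -sumEFin le_eqVlt; apply/orP; left; apply/eqP.
by apply: eq_big_nat => k; rewrite ltnS => kn; rewrite -EFinM test_coef_powR.
Qed.

Let young x n : X x -> `|g x| * test_fun n x <=
  (C * H) `^ q / q * (`|g x| `^ q * omega x `^ (- q)) +
  (C * H) `^ (- p) / p * (test_fun n x * omega x) `^ p.
Proof.
move=> Xx; have o0 := omega_gt0 Xx; have t0 : 0 < C * H by rewrite mulr_gt0.
have q0 : 0 < q by rewrite (lt_trans ltr01).
have p0 : 0 < p by rewrite (lt_trans ltr01).
(* The weight and the scale t = C H are distributed over the two factors before Young's inequality;
   with this t the Hardy term becomes exactly [tail_energy n / p]. *)
have -> : `|g x| * test_fun n x =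
    (C * H * (`|g x| / omega x)) * (test_fun n x * omega x / (C * H)).
  by field; rewrite !gt_eqF.
apply: (le_trans (@conjugate_powR _ _ _ q p _ _ q0 p0 _)).
- by rewrite mulr_ge0 ?divr_ge0// ltW.
- by rewrite divr_ge0 ?mulr_ge0 ?test_fun_ge0// ltW.
- by rewrite addrC.
have inv (a r : R) : 0 < a -> a^-1 `^ r = a `^ (- r).
  by move=> a0; rewrite -powR_inv1 ?(ltW a0)// -powRrM mulN1r.
rewrite (powRM _ (ltW t0)) ?divr_ge0 ?(ltW o0)//.
rewrite (powRM _ (normr_ge0 _)) ?invr_ge0 ?(ltW o0)// (inv _ _ o0).
rewrite (powRM p) ?invr_ge0 ?(ltW t0)//; last first.
  by rewrite mulr_ge0 ?test_fun_ge0// ltW.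
by rewrite (inv _ _ t0) le_eqVlt; apply/orP; left; apply/eqP; ring.
Qed.

Lemma dual_hardy n : ((tail_energy n)%:E <= ((C * H) `^ q)%:E *
  \int[mu]_(x in X) (`|g x| `^ q * omega x `^ (- q))%:E)%E.
Proof.
have t0 : 0 < C * H by rewrite mulr_gt0.
have q0 : 0 < q by rewrite (lt_trans ltr01).
have p0 : 0 < p by rewrite (lt_trans ltr01).
set G := (\int[mu]_(x in X) _)%E.
have G0 : (0 <= G)%E.
  by apply: integral_ge0 => x _; rewrite lee_fin mulr_ge0 ?powR_ge0.
have mF : measurable_fun X (fun x => `|g x| `^ q * omega x `^ (- q)).
  by apply: measurable_funM; apply: mpow => //; exact: mabsg.
have mS : measurable_fun X (fun x => (test_fun n x * omega x) `^ p).
  by apply: mpow; exact: measurable_funM.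
have : ((tail_energy n)%:E <= ((C * H) `^ q / q)%:E * G +
    ((C * H) `^ (- p) / p)%:E * ((C * H) `^ p * tail_energy n)%:E)%E.
  rewrite -integral_mul_test.
  apply: (@le_trans _ _ (\int[mu]_(x in X)
      (((C * H) `^ q / q)%:E * (`|g x| `^ q * omega x `^ (- q))%:E +
      ((C * H) `^ (- p) / p)%:E * ((test_fun n x * omega x) `^ p)%:E))%E).
    apply: ge0_le_integral => //.
    - by move=> x _; rewrite lee_fin mulr_ge0 ?test_fun_ge0.
    - by apply/measurable_EFinP; apply: measurable_funM => //; exact: mabsg.
    - by apply/measurable_EFinP; apply: measurable_funD; apply: measurable_funM.
    - by move=> x Xx; rewrite lee_fin; exact: young.
  have nneg (a b : R) : 0 <= a -> 0 <= b -> (0 <= a%:E * b%:E)%E.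
    by move=> a0 b0; rewrite -EFinM lee_fin mulr_ge0.
  have cq0 : 0 <= (C * H) `^ q / q by rewrite divr_ge0 ?powR_ge0// ltW.
  have cp0 : 0 <= (C * H) `^ (- p) / p by rewrite divr_ge0 ?powR_ge0// ltW.
  rewrite ge0_integralD//; last 4 first.
    by move=> x _; rewrite nneg// mulr_ge0 ?powR_ge0.
    by apply/measurable_EFinP; exact: measurable_funM.
    by move=> x _; rewrite nneg ?powR_ge0.
    by apply/measurable_EFinP; exact: measurable_funM.
  rewrite ge0_integralZl_EFin//; last 2 first.
    by move=> x _; rewrite lee_fin mulr_ge0 ?powR_ge0.
    exact/measurable_EFinP.
  rewrite ge0_integralZl_EFin//; last 2 first.
    by move=> x _; rewrite lee_fin powR_ge0.
    exact/measurable_EFinP.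
  by rewrite leeD2l// lee_wpmul2l ?lee_fin// integral_test_powR.
have tq : 0 < (C * H) `^ q by rewrite powR_gt0.
(* If the energy of g is infinite, the bound is trivial because its factor is positive; otherwise
   everything is real and can be subtracted. *)
case: G G0 => [G G0|_|//]; last by move=> _; rewrite gt0_muley ?lte_fin// leey.
rewrite -!EFinM -EFinD !lee_fin.
have -> : (C * H) `^ (- p) / p * ((C * H) `^ p * tail_energy n) = tail_energy n / p.
  by rewrite powRN; field; rewrite !gt_eqF ?powR_gt0.
(* Absorption: moving [tail_energy n / p] to the left leaves [tail_energy n / q]. *)
have -> : p^-1 = 1 - q^-1 by rewrite -pq addrK.
move=> le1; have : tail_energy n / q <= (C * H) `^ q * G / q by lra.
by rewrite ler_pM2r ?invr_gt0.
Qed.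

End DualHardy.

(** * The decomposition *)

Section Decomposition.
Context d (T : measurableType d) (R : realType).
Context (mu : {measure set T -> \bar R}) (p q : R) (D B Om : nat -> set T).
Context (omega g : T -> R) (w m b : nat -> R) (C H : R).
Local Notation X := (\bigcup_k D k).
Local Notation tail := (tail D).
Local Notation tail_mass := (tail_mass mu D g).
Local Notation mass_term := (mass_term mu q D g w m).
Hypotheses (p1 : 1 < p) (q1 : 1 < q) (pq : p^-1 + q^-1 = 1).
Hypotheses (mD : forall k, measurable (D k)) (tD : trivIset setT D).
Hypotheses (mB : forall k, measurable (B k)) (mOm : forall k, measurable (Om k)).
Hypotheses (BD : forall k, B k `<=` D k) (DOm : forall k, D k `<=` Om k).
Hypotheses (BOm : forall k, B k.+1 `<=` Om k) (OmX : forall k, Om k `<=` X).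
Hypotheses (muB : forall k, mu (B k) = (b k)%:E) (b_gt0 : forall k, 0 < b k).
Hypotheses (muOm : forall k, mu (Om k) = (m k)%:E).
Hypothesis m_le : forall k, m k <= 2 * b k.
Hypotheses (C_ge1 : 1 <= C) (H_ge1 : 1 <= H).
Hypotheses (w_gt0 : forall k, (1 <= k)%N -> 0 < w k).
Hypothesis momega : measurable_fun X omega.
Hypothesis omega_gt0 : forall x, X x -> 0 < omega x.
Hypothesis omega_le : forall k, (1 <= k)%N ->
  {ae mu, forall x, D k x -> omega x <= C * w k}.
Hypothesis omega_ge : forall k, (1 <= k)%N ->
  {ae mu, forall x, D k x -> w k <= C * omega x}.
Hypothesis hardy : forall d : nat -> R, (forall j, (1 <= j)%N -> 0 <= d j) ->
  (\sum_(1 <= j <oo) ((m j)%:E *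
     (w j `^ p * (\sum_(1 <= i < j.+1) d i) `^ p)%:E)
   <= (H `^ p)%:E *
      \sum_(1 <= j <oo) ((m j)%:E * (w j `^ p * d j `^ p)%:E))%E.
Hypothesis ig : mu.-integrable X (EFin \o g).
Hypothesis g0 : (\int[mu]_(x in X) (g x)%:E = 0)%E.

Let mX : measurable X. Proof. exact: bigcup_measurable. Qed.

Let mtail i : measurable (tail i). Proof. exact: measurable_tail. Qed.

Let igS A : measurable A -> A `<=` X -> mu.-integrable A (EFin \o g).
Proof. by move=> mA AX; exact: integrableS ig. Qed.

Let DX k : D k `<=` X. Proof. by move=> x Dx; exists k. Qed.

Let BX k : B k `<=` X. Proof. exact: subset_trans (@BD k) (@DX k). Qed.

Let m_gt0 k : 0 < m k.
Proof.
rewrite (lt_le_trans (b_gt0 k))// -lee_fin -muB -muOm le_measure ?inE//.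
exact: subset_trans (@BD k) (@DOm k).
Qed.

Definition tail_int i := fine (\int[mu]_(x in tail i) (g x)%:E)%E.

Lemma tail_intE i : ((tail_int i)%:E = \int[mu]_(x in tail i) (g x)%:E)%E.
Proof.
rewrite /tail_int fineK//; apply: integrable_fin_num => //.
by apply: igS => //; exact: tail_sub.
Qed.

(** The zero mean of g enters here: it makes [flux 0] vanish, so no mass has to leave the first
    piece. *)
Lemma tail_int0 : tail_int 0 = 0.
Proof. by rewrite /tail_int tail0 g0. Qed.

Lemma tail_intS k :
  ((tail_int k)%:E = \int[mu]_(x in D k) (g x)%:E + (tail_int k.+1)%:E)%E.
Proof.
rewrite !tail_intE tailS integral_setU//; last exact: tail_disj.
apply: measurable_int; apply: igS; first exact: measurableU.
by rewrite -tailS; exact: tail_sub.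
Qed.

Lemma tail_int_le k : `|tail_int k| <= tail_mass k.
Proof.
rewrite -lee_fin -abse_EFin tail_intE (tail_massE mD ig).
apply: le_abse_integral => //; apply: measurable_int; apply: igS => //.
exact: tail_sub.
Qed.

(** Height of the constant function on [B k] whose integral is A_k. *)
Definition flux k := tail_int k / b k.

Definition orth_piece k x :=
  g x * \1_(D k) x - flux k * \1_(B k) x + flux k.+1 * \1_(B k.+1) x.

Let flux0 : flux 0 = 0. Proof. by rewrite /flux tail_int0 mul0r. Qed.

Let ig_indic A k : measurable A -> D k `<=` A -> A `<=` X ->
  mu.-integrable A (fun x => (g x * \1_(D k) x)%:E).
Proof. by move=> mA DA AX; apply: integrable_mul_indic => //; exact: igS. Qed.

Let iflux A k : measurable A -> B k `<=` A ->
  mu.-integrable A (fun x => (flux k * \1_(B k) x)%:E).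
Proof.
move=> mA BA; apply: (@integrable_mul_indic _ _ _ _ _ _ (cst (flux k))) => //.
apply: measurable_bounded_integrable => //.
  by rewrite (_ : (mu _ < +oo)%E)// muB ltry.
exact: bounded_cst.
Qed.

(** The three terms integrate to the integral of g over [D k], to -A_k and to A_(k+1), which cancel
    by [tail_intS]. The domain A is left free: [Om k] gives the mean-zero condition, the whole union
    gives global integrability. *)
Lemma orth_piece_mean0 A k :
  measurable A -> D k `<=` A -> B k.+1 `<=` A -> A `<=` X ->
  mu.-integrable A (EFin \o orth_piece k) /\
  (\int[mu]_(x in A) (orth_piece k x)%:E = 0)%E.
Proof.
move=> mA DA BA AX.
have BkA : B k `<=` A by exact: subset_trans (@BD k) DA.
have i1 := ig_indic mA DA AX; have i2 := iflux mA BkA; have i3 := iflux mA BA.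
have -> : EFin \o orth_piece k = (((fun x => (g x * \1_(D k) x)%:E) \-
    (fun x => (flux k * \1_(B k) x)%:E)) \+
    (fun x => (flux k.+1 * \1_(B k.+1) x)%:E))%E by [].
have i12 := integrableB mA i1 i2.
split; first exact: integrableD.
rewrite (integralD mA i12 i3) (integralB mA i1 i2).
have iB j : B j `<=` A ->
    (\int[mu]_(x in A) (flux j * \1_(B j) x)%:E = (tail_int j)%:E)%E.
  move=> BjA; rewrite (integral_mul_indic _ (cst (flux j)))//.
  by rewrite (integral_cst mu (mB j) (flux j)%:E) muB -EFinM /= divfK// gt_eqF.
rewrite !iB// integral_mul_indic// (tail_intS k).
(* Cancelling in the extended reals requires this integral to be finite. *)
have : (\int[mu]_(x in D k) (g x)%:E)%E \is a fin_num.
  by apply: integrable_fin_num => //; exact: igS.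
case: (\int[mu]_(x in D k) _)%E => // r _.
by apply: (congr1 EFin (_ : r - (r + tail_int k.+1) + tail_int k.+1 = 0)); ring.
Qed.

Lemma orth_piece_support k x : orth_piece k x != 0 -> Om k x.
Proof.
apply: contra_neqP => nO; rewrite /orth_piece !indicE.
have -> : (x \in D k) = false by apply/negP; rewrite inE => /DOm.
have -> : (x \in B k) = false by apply/negP; rewrite inE => /BD/DOm.
have -> : (x \in B k.+1) = false by apply/negP; rewrite inE => /BOm.
by rewrite !mulr0 subr0 addr0.
Qed.

(** The incoming term of piece k on [B k.+1] is the outgoing term of piece k + 1, so the sum
    telescopes; the lower end vanishes with [flux 0]. *)
Lemma sum_orth_piece n x : \sum_(0 <= k < n) orth_piece k x =
  \sum_(0 <= k < n) g x * \1_(D k) x + flux n * \1_(B n) x.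
Proof.
elim: n => [|n IH]; first by rewrite !big_geq// flux0 mul0r addr0.
by rewrite !big_nat_recr//= IH /orth_piece; ring.
Qed.

(** The partial sums are eventually constant: if x is in [D k] and n > k, exactly one slice before n
    contains x, and the leftover term on [B n] misses x. *)
Lemma series_orth_piece x : X x -> series (fun k => orth_piece k x) @ \oo --> g x.
Proof.
move=> [k _ Dk]; apply: cvg_near_cst; near=> n.
have kn : (k < n)%N by near: n; exact: nbhs_infty_gt.
rewrite /series/= sum_orth_piece.
have Dj j : (x \in D j) = (j == k).
  apply/idP/eqP => [|->]; last by rewrite inE.
  by rewrite inE => Dj; exact: (trivIset_index tD Dj Dk).
have -> : \1_(B n) x = 0 :> R.
  rewrite indicE; case: (boolP (x \in B n)) => //; rewrite inE => /BD Dn.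
  by move: kn; rewrite (trivIset_index tD Dk Dn) ltnn.
under eq_bigr => j _ do rewrite indicE Dj mulr_natr mulrb.
rewrite mulr0 addr0 -big_mkcond/= big_mkord.
by rewrite (big_pred1 (Ordinal kn))// => i /=; rewrite -val_eqE.
Unshelve. all: by end_near. Qed.

(** * Energy estimates for the pieces *)

Let q0 : 0 < q. Proof. exact: lt_trans ltr01 q1. Qed.

Let C0 : 0 < C. Proof. exact: lt_le_trans ltr01 C_ge1. Qed.

Let H0 : 0 < H. Proof. exact: lt_le_trans ltr01 H_ge1. Qed.

Let mg : measurable_fun X g.
Proof. by apply/measurable_EFinP; exact: measurable_int ig. Qed.

Let mpow (r : R) (f : T -> R) A :
  measurable_fun A f -> measurable_fun A (fun x => f x `^ r).
Proof. exact: (@measurableT_comp _ _ _ _ _ _ (@powR R ^~ r)). Qed.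

Let mo A r : A `<=` X -> measurable_fun A (fun x => omega x `^ r).
Proof. by move=> AX; apply: mpow; exact: measurable_funS momega. Qed.

Let mF A : A `<=` X -> measurable_fun A (fun x => `|g x| `^ q * omega x `^ (- q)).
Proof.
move=> AX; apply: measurable_funM; last exact: mo.
by apply: mpow; apply: measurableT_comp => //; exact: measurable_funS mg.
Qed.

(** [D k] and [B k.+1] lie in different slices, so g overlaps only the outgoing flux. The factor 2^q
    is paid on [D k] alone, and the incoming flux keeps the factor 1. *)
Lemma orth_piece_powR k x : `|orth_piece k x| `^ q <=
  2 `^ q * `|g x| `^ q * \1_(D k) x + 2 `^ q * `|flux k| `^ q * \1_(B k) x +
  `|flux k.+1| `^ q * \1_(B k.+1) x.
Proof.
rewrite /orth_piece !indicE; have [Dx|nDx] := boolP (x \in D k).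
  have -> : (x \in B k.+1) = false.
    apply/negP; rewrite inE => /BD; move: Dx; rewrite inE => Dx Dx'.
    by have := trivIset_index tD Dx Dx'; exact: n_Sn.
  rewrite !mulr0 !addr0 !mulr1; case: (x \in B k).
    by rewrite !mulr1 normB_powR_le// ltW.
  rewrite !mulr0 subr0 addr0 ler_peMl ?powR_ge0//.
  by rewrite (@le_trans _ _ 2) ?ler1n// le1r_powR ?ler1n ?ltW.
have -> : (x \in B k) = false.
  by apply: contraNF nDx; rewrite !inE => /BD.
rewrite !mulr0 subrr !add0r; case: (x \in B k.+1); rewrite ?mulr1// !mulr0.
by rewrite normr0 powR0// gt_eqF.
Qed.

Definition flux_energy k :=
  (\int[mu]_(x in B k) (`|flux k| `^ q * omega x `^ (- q))%:E)%E.

Lemma flux_energy_ge0 k : (0 <= flux_energy k)%E.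
Proof. by apply: integral_ge0 => x _; rewrite lee_fin mulr_ge0 ?powR_ge0. Qed.

Lemma flux_energy0 : flux_energy 0 = 0%E.
Proof.
by apply: integral0_eq => x _; rewrite flux0 normr0 powR0 ?mul0r// gt_eqF.
Qed.

Lemma orth_piece_energy k :
  (\int[mu]_(x in Om k) (`|orth_piece k x| `^ q * omega x `^ (- q))%:E <=
   (2 `^ q)%:E * \int[mu]_(x in D k) (`|g x| `^ q * omega x `^ (- q))%:E +
   (2 `^ q)%:E * flux_energy k + flux_energy k.+1)%E.
Proof.
have OX := @OmX k.
have BkO : B k `<=` Om k by exact: subset_trans (@BD k) (@DOm k).
have moO := mo (- q) OX.
set f1 := fun x => 2 `^ q * (`|g x| `^ q * omega x `^ (- q)).
set f2 := fun x => 2 `^ q * (`|flux k| `^ q * omega x `^ (- q)).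
set f3 := fun x => `|flux k.+1| `^ q * omega x `^ (- q).
have f10 x : 0 <= f1 x by rewrite !mulr_ge0 ?powR_ge0.
have f20 x : 0 <= f2 x by rewrite !mulr_ge0 ?powR_ge0.
have f30 x : 0 <= f3 x by rewrite !mulr_ge0 ?powR_ge0.
have mf1 : measurable_fun (Om k) f1 by apply: measurable_funM => //; exact: mF.
have mf2 : measurable_fun (Om k) f2 by do 2 apply: measurable_funM => //.
have mf3 : measurable_fun (Om k) f3 by apply: measurable_funM.
have i0 (A : set T) x : 0 <= \1_A x :> R by rewrite indicE; case: (_ \in _).
have h1 x : 0 <= f1 x * \1_(D k) x by exact: mulr_ge0.
have h2 x : 0 <= f2 x * \1_(B k) x by exact: mulr_ge0.
have h3 x : 0 <= f3 x * \1_(B k.+1) x by exact: mulr_ge0.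
have mi (f : T -> R) A : measurable_fun (Om k) f -> measurable A ->
    measurable_fun (Om k) (fun x => (f x * \1_A x)%:E).
  by move=> mf mA; apply/measurable_EFinP; apply: measurable_funM.
apply: (@le_trans _ _ (\int[mu]_(x in Om k) ((f1 x * \1_(D k) x)%:E +
    (f2 x * \1_(B k) x)%:E + (f3 x * \1_(B k.+1) x)%:E))%E).
  apply: ge0_le_integral => //.
  - by move=> x _; rewrite lee_fin mulr_ge0 ?powR_ge0.
  - apply/measurable_EFinP; apply: measurable_funM => //; apply: mpow.
    apply: measurableT_comp => //; apply/measurable_EFinP.
    apply: measurable_int; apply: (orth_piece_mean0 (mOm k) _ _ OX).1.
      exact: DOm.
    exact: BOm.
  - by do !apply: emeasurable_funD; exact: mi.
  move=> x _; rewrite -!EFinD lee_fin /f1 /f2 /f3.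
  apply: (le_trans (ler_wpM2r (powR_ge0 _ _) (orth_piece_powR k x))).
  by rewrite le_eqVlt; apply/orP; left; apply/eqP; ring.
rewrite ge0_integralD//; last 4 first.
  by move=> x _; rewrite -EFinD lee_fin addr_ge0.
  by apply: emeasurable_funD; exact: mi.
  by move=> x _; rewrite lee_fin.
  exact: mi.
rewrite ge0_integralD//; last 4 first.
  by move=> x _; rewrite lee_fin.
  exact: mi.
  by move=> x _; rewrite lee_fin.
  exact: mi.
rewrite !integral_mul_indic//.
under eq_integral do rewrite EFinM.
rewrite ge0_integralZl_EFin ?powR_ge0//; last 2 first.
  by move=> x _; rewrite lee_fin mulr_ge0 ?powR_ge0.
  by apply/measurable_EFinP; exact: mF.
under [X in (_ + X + _)%E]eq_integral do rewrite EFinM.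
rewrite ge0_integralZl_EFin ?powR_ge0//.
  by move=> x _; rewrite lee_fin mulr_ge0 ?powR_ge0.
by apply/measurable_EFinP; apply: measurable_funM => //; exact: mo.
Qed.

(** On [B k] the weight is at least w_k / C almost everywhere, which costs C^q. What remains is
    |A_k|^q b_k^(1-q), controlled through |A_k| <= a_k and m_k <= 2 b_k. *)
Lemma flux_energy_le k : (1 <= k)%N ->
  (flux_energy k <= (2 `^ (q - 1) * C `^ q * mass_term k)%:E)%E.
Proof.
move=> k1; have w0 := w_gt0 k1; have b0 := b_gt0 k.
apply: (@le_trans _ _ (\int[mu]_(x in B k)
    (cst (`|flux k| `^ q * (C `^ q * w k `^ (- q)))%:E) x)%E).
  apply: ae_ge0_le_integral => //.
  - by move=> x _; rewrite lee_fin mulr_ge0 ?powR_ge0.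
  - by apply/measurable_EFinP; apply: measurable_funM => //; exact: mo.
  - by move=> x _; rewrite lee_fin !mulr_ge0 ?powR_ge0.
  have := omega_ge k1; apply: filterS => x ox Bx; have Dx := BD Bx.
  have o0 := omega_gt0 (DX Dx).
  rewrite lee_fin ler_wpM2l ?powR_ge0// !powRN ler_pdivlMr ?powR_gt0//.
  rewrite mulrC ler_pdivrMr ?powR_gt0// -powRM ?(ltW C0) ?(ltW o0)//.
  rewrite ge0_ler_powR ?nnegrE ?mulr_ge0 ?(ltW q0) ?(ltW C0)//.
  - exact: ltW.
  - exact: ltW.
  - exact: ox.
rewrite (integral_cst mu (mB k) _%:E) muB -EFinM lee_fin /mass_term.
have t0 : 0 <= tail_mass k by exact: tail_mass_ge0.
have -> : `|flux k| `^ q * (C `^ q * w k `^ (- q)) * b k =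
    C `^ q * w k `^ (- q) * (`|tail_int k| `^ q * b k `^ (1 - q)).
  rewrite /flux normrM (gtr0_norm (_ : 0 < (b k)^-1)) ?invr_gt0//.
  rewrite powRM ?invr_ge0 ?(ltW b0)// -(powR_inv1 (ltW b0)) -powRrM mulN1r.
  rewrite (powRD (x := b k)) ?(gt_eqF b0) ?implybT// (powRr1 (ltW b0)).
  by ring.
have tq : `|tail_int k| `^ q <= tail_mass k `^ q.
  by rewrite ge0_ler_powR ?nnegrE ?(ltW q0)// tail_int_le.
(* Since 1 - q is negative, m_k <= 2 b_k yields an upper bound for b_k^(1-q), at the price of
   2^(q-1). *)
have bq : b k `^ (1 - q) <= 2 `^ (q - 1) * m k `^ (1 - q).
  rewrite -[X in b k `^ X]opprB -[X in m k `^ X]opprB !powRN.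
  rewrite ler_pdivlMr ?powR_gt0// mulrC ler_pdivrMr ?powR_gt0//.
  rewrite -powRM ?(ltW b0)// ge0_ler_powR ?nnegrE ?subr_ge0 ?(ltW q1)//.
    exact: ltW.
  by rewrite mulr_ge0// ltW.
have -> : 2 `^ (q - 1) * C `^ q *
    (m k `^ (1 - q) * w k `^ (- q) * tail_mass k `^ q) =
  C `^ q * w k `^ (- q) * (tail_mass k `^ q * (2 `^ (q - 1) * m k `^ (1 - q))).
  by ring.
by rewrite ler_wpM2l ?mulr_ge0 ?powR_ge0// ler_pM ?powR_ge0.
Qed.

Let lee_sum3 (x : R) (a e f : nat -> \bar R) (u v : \bar R) n : 0 <= x ->
  (forall k, 0 <= a k)%E -> (forall k, 0 <= e k)%E ->
  (\sum_(0 <= k < n) a k <= u)%E -> (\sum_(0 <= k < n) e k <= v)%E ->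
  (\sum_(0 <= k < n) f k <= v)%E ->
  (\sum_(0 <= k < n) (x%:E * a k + x%:E * e k + f k) <=
   x%:E * u + x%:E * v + v)%E.
Proof.
move=> x0 a0 e0 au ev fv; rewrite big_split big_split /=.
rewrite -ge0_sume_distrr// -ge0_sume_distrr//.
by apply: leeD => //; apply: leeD; apply: lee_wpmul2l => //; rewrite lee_fin.
Qed.

(** [D k] lies in [Om k], so the dual Hardy bound applies with m_k the measure of [Om k]. *)
Let mass_sum_le n : ((\sum_(1 <= k < n.+1) mass_term k)%:E <=
  ((C * H) `^ q)%:E * \int[mu]_(x in X) (`|g x| `^ q * omega x `^ (- q))%:E)%E.
Proof.
apply: (dual_hardy p1 q1 pq mD tD m_gt0 _ C0 H0 w_gt0) => // k.
by rewrite -muOm le_measure ?inE.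
Qed.

Let flux_sum_le n : (\sum_(1 <= k < n.+1) flux_energy k <=
  (2 `^ (q - 1) * C `^ q * (C * H) `^ q)%:E *
    \int[mu]_(x in X) (`|g x| `^ q * omega x `^ (- q))%:E)%E.
Proof.
rewrite EFinM -muleA; have c0 : 0 <= 2 `^ (q - 1) * C `^ q.
  by rewrite mulr_ge0 ?powR_ge0.
apply: (@le_trans _ _ ((2 `^ (q - 1) * C `^ q)%:E *
    (\sum_(1 <= k < n.+1) mass_term k)%:E)%E); last first.
  by apply: lee_wpmul2l; [rewrite lee_fin | exact: mass_sum_le].
rewrite -EFinM mulr_sumr -sumEFin big_nat_cond [leRHS]big_nat_cond.
by apply: lee_sum => k /andP[/andP[k1 _] _]; exact: flux_energy_le.
Qed.

(** The slices are disjoint, so the g terms add up to at most one copy of the energy of g. Each flux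
    energy is counted at most twice: outgoing with factor 2^q, incoming with factor 1. *)
Lemma energy_le : (\sum_(0 <= k <oo)
    \int[mu]_(x in Om k) (`|orth_piece k x| `^ q * omega x `^ (- q))%:E <=
  ((2 `^ (2 + q^-1) * C ^+ 2 * H) `^ q)%:E *
    \int[mu]_(x in X) (`|g x| `^ q * omega x `^ (- q))%:E)%E.
Proof.
have e0 A (f : T -> R) :
    (0 <= \int[mu]_(x in A) (`|f x| `^ q * omega x `^ (- q))%:E)%E.
  by apply: integral_ge0 => x _; rewrite lee_fin mulr_ge0 ?powR_ge0.
apply: lime_le; first exact: is_cvg_nneseries.
apply: nearW => n; set G := (\int[mu]_(x in X) _)%E.
have G0 : (0 <= G)%E by exact: e0.
have DG : (\sum_(0 <= k < n)
    \int[mu]_(x in D k) (`|g x| `^ q * omega x `^ (- q))%:E <= G)%E.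
  rewrite /G ge0_integral_bigcup//.
  - exact: nneseries_lim_ge.
  - by apply/measurable_EFinP; exact: mF.
  - by move=> x _; rewrite lee_fin mulr_ge0 ?powR_ge0.
have S1 : (\sum_(0 <= k < n) flux_energy k.+1 <=
    (2 `^ (q - 1) * C `^ q * (C * H) `^ q)%:E * G)%E.
  by apply: le_trans (flux_sum_le n); rewrite [leRHS]big_add1.
have S0 : (\sum_(0 <= k < n) flux_energy k <=
    (2 `^ (q - 1) * C `^ q * (C * H) `^ q)%:E * G)%E.
  (* Index 0 adds nothing because [flux 0] vanishes, so the bound for sums starting at 1 applies. *)
  apply: le_trans (flux_sum_le n); case: n {DG S1} => [|n].
    by rewrite !big_geq.
  rewrite big_nat_recl// flux_energy0 add0e [leRHS]big_add1 /= big_nat_recr//=.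
  by apply: leeDl; exact: flux_energy_ge0.
apply: (@le_trans _ _ (\sum_(0 <= k < n) ((2 `^ q)%:E *
    \int[mu]_(x in D k) (`|g x| `^ q * omega x `^ (- q))%:E +
    (2 `^ q)%:E * flux_energy k + flux_energy k.+1))%E).
  by apply: lee_sum => k _; exact: orth_piece_energy.
set K := 2 `^ (q - 1) * C `^ q * (C * H) `^ q in S0 S1.
apply: (@le_trans _ _ ((2 `^ q)%:E * G + (2 `^ q)%:E * (K%:E * G) + K%:E * G)%E).
  exact: (@lee_sum3 (2 `^ q) (fun k => \int[mu]_(x in D k)
      (`|g x| `^ q * omega x `^ (- q))%:E)%E flux_energy (flux_energy \o succn) G
    (K%:E * G)%E n (powR_ge0 2 q) (fun k => e0 (D k) g) flux_energy_ge0 DG S0 S1).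
set M := (2 `^ (2 + q^-1) * C ^+ 2 * H) `^ q.
have M0 : 0 < M.
  by rewrite powR_gt0// !mulr_gt0 ?powR_gt0 ?exprn_gt0.
(* With x = 2^q and y = C^(2q) H^q one has K = x y / 2, and M = 2 x^2 y because (2 + 1/q) q = 2 q +
   1. The claim reads x + x^2 y / 2 + x y / 2 <= 2 x^2 y. *)
suff KM : 2 `^ q + 2 `^ q * K + K <= M.
  move: G0 {DG S0 S1}; case: G => [r|_|//]; last first.
    by rewrite [leRHS]gt0_muley ?leey ?lte_fin.
  rewrite -!EFinM -!EFinD !lee_fin => r0.
  by rewrite mulrA -!mulrDl ler_wpM2r.
have ge1 (a : R) : 1 <= a -> 1 <= a `^ q.
  by move=> a1; rewrite (le_trans a1)// le1r_powR// ltW.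
have -> : M = 2 * (2 `^ q) ^+ 2 * (C `^ q) ^+ 2 * H `^ q.
  rewrite /M !powRM ?mulr_ge0 ?exprn_ge0 ?powR_ge0 ?(ltW C0) ?(ltW H0)//.
  rewrite -powRrM (_ : (2 + q^-1) * q = 1 + (q + q)); last first.
    by field; rewrite gt_eqF.
  by rewrite !powRD ?pnatr_eq0 ?implybT// powRr1//; ring.
have -> : K = 2 `^ q / 2 * (C `^ q) ^+ 2 * H `^ q.
  rewrite /K powRB ?pnatr_eq0 ?implybT// powRr1// powRM ?(ltW C0) ?(ltW H0)//.
  by ring.
have xge := ge1 2 (ler1n _ 2); have cge := ge1 _ C_ge1; have hge := ge1 _ H_ge1.
move: xge cge hge; set x := 2 `^ q; set c := C `^ q; set h := H `^ q.
(* C >= 1 and H >= 1 enter here: they give x <= x y, which compares the g term, free of C and H,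
   with M. *)
move=> xge cge hge; have ch : 1 <= c ^+ 2 * h.
  by rewrite mulr_ege1// exprn_ege1.
rewrite -!(mulrA _ (c ^+ 2) h); move: (c ^+ 2 * h) ch => y y1.
have x_ge0 : 0 <= x by rewrite (le_trans ler01).
have xy : x <= x * y by rewrite ler_peMr.
have xxy : x * y <= x * (x * y) by rewrite ler_peMl// mulr_ge0// (le_trans ler01).
by lra.
Qed.

End Decomposition.

(** * Geometry of the cusp *)

Section CuspGeometry.
Context {R : realType}.
Variable gamma : R.
Hypothesis gamma0 : 0 <= gamma.
Local Notation mu := (@plane_measure R).

Lemma measurable_rect (A B : set (measurableTypeR R)) :
  measurable A -> measurable B ->
  measurable (A `*` B : set (plane R)).
Proof.
by move=> mA mB; apply: caratheodory_measurable_mu_ext; exact: measurableX.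
Qed.

Lemma plane_measure_rect (A B : set (measurableTypeR R)) :
  measurable A -> measurable B ->
  mu (A `*` B) = (lebesgue_measure A * lebesgue_measure B)%E.
Proof.
move=> mA mB; rewrite -product_measure1E//.
by apply: measurable_mu_extE; exact: measurableX.
Qed.

(** Slices, pieces and vertical fibres all have this form, so measurability and area bounds are
    proved once. *)
Definition slab (A : set R) : set (plane R) := cusp gamma `&` [set x | A x.1].

Lemma measurable_slab (A : set (measurableTypeR R)) :
  measurable A -> measurable (slab A).
Proof.
move=> mA; apply: caratheodory_measurable_mu_ext.
pose T := (measurableTypeR R * measurableTypeR R)%type.
have mlt (f h : T -> R) : measurable_fun setT f -> measurable_fun setT h ->
    measurable [set x | f x < h x].
  move=> mf mh; rewrite -[X in measurable X]setTI.
  by apply: (measurable_fun_ltr mf mh measurableT (_ : measurable [set true])).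
have m1 : measurable_fun [set: T] fst := measurable_fst.
have m2 : measurable_fun [set: T] snd := measurable_snd.
have mp : measurable_fun [set: T] (fun x => x.1 `^ gamma).
  exact: (@measurableT_comp _ _ _ _ _ _ (@powR R ^~ gamma)).
rewrite (_ : slab A =
    [set x : T | 0 < x.1] `&` [set x : T | x.1 < 1] `&`
    [set x : T | 0 < x.2] `&` [set x : T | x.2 < x.1 `^ gamma] `&`
    (setT `&` fst @^-1` A)).
  apply: measurableI; last exact: m1.
  by do !apply: measurableI; apply: mlt => //; exact: measurable_cst.
rewrite setTI; apply/seteqP; split => x /=; rewrite /slab /cusp /=.
  by move=> [[/andP[? ?] /andP[? ?]] ?].
by move=> [[[[? ?] ?] ?] ?]; split; [split|] => //; apply/andP.
Qed.

(** The profile is nondecreasing as gamma >= 0, so the slab fits in a rectangle of height b^gamma.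
    Taking a = b shows that fibres are null sets; a = 0 and b = 1 give finiteness of the areas. *)
Lemma slab_le (a b : R) (A : set (measurableTypeR R)) :
  measurable A -> 0 <= a -> a <= b ->
  A `<=` `[a, b] -> (mu (slab A) <= ((b - a) * b `^ gamma)%:E)%E.
Proof.
move=> mA a0 ab Aab.
have -> : ((b - a) * b `^ gamma)%:E =
    mu (`[a, b]%classic `*` `]0, b `^ gamma[%classic).
  rewrite plane_measure_rect// !lebesgue_measure_itv/= !lte_fin.
  have [->|ab'] := eqVneq a b.
    by rewrite ltxx subrr mul0r mul0e.
  have b0 : 0 < b by rewrite (le_lt_trans a0)// lt_neqAle ab'.
  by rewrite powR_gt0// lt_neqAle ab' ab/= sube0 -EFinD -EFinM.
rewrite le_measure ?inE//.
- exact: measurable_slab.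
- exact: measurable_rect.
move=> x [[/andP[x0 _] /andP[x20 x2]] /Aab]; rewrite /= in_itv/= => /andP[ax xb].
split; rewrite /= ?in_itv/=; first by rewrite ax xb.
rewrite x20 (lt_le_trans x2)// ge0_ler_powR ?nnegrE ?(ltW x0)//.
exact: le_trans a0 ab.
Qed.

Lemma slab_ge (a b : R) : 0 < a -> a < b -> b <= 1 ->
  (((b - a) * a `^ gamma)%:E <= mu (slab `]a, b[))%E.
Proof.
move=> a0 ab b1.
have -> : ((b - a) * a `^ gamma)%:E =
    mu (`]a, b[%classic `*` `]0, a `^ gamma[%classic).
  rewrite plane_measure_rect// !lebesgue_measure_itv/= !lte_fin.
  by rewrite powR_gt0// ab sube0 -EFinD -EFinM.
rewrite le_measure ?inE//.
- exact: measurable_rect.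
- exact: measurable_slab.
move=> [x y] /=; rewrite !in_itv/= => -[/andP[ax xb] /andP[y0 ya]].
split; last by rewrite /= ?in_itv/= ax xb.
have x0 := lt_trans a0 ax; split => /=; first by rewrite x0 (lt_le_trans xb).
rewrite y0 (lt_le_trans ya)// ge0_ler_powR ?nnegrE ?(ltW a0) ?(ltW x0) ?(ltW ax)//.
Qed.

(** Half-open slices cover the cusp without overlap. The open ones drop the left fibre x_1 =
    2^-(k+1), which the piece of index k - 1 does not contain. *)
Definition dyadic_half_open k := slab `[2 ^- k.+1, 2 ^- k[.
Definition dyadic_open k := slab `]2 ^- k.+1, 2 ^- k[.
Local Notation D := dyadic_half_open.
Local Notation B := dyadic_open.
Local Notation Om := (cusp_piece gamma).

Let e_gt0 k : 0 < 2 ^- k :> R. Proof. by rewrite invr_gt0 exprn_gt0. Qed.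

Let eS k : 2 ^- k.+1 = 2 ^- k / 2 :> R. Proof. by rewrite exprS invfM mulrC. Qed.

Let e_lt k : 2 ^- k.+1 < 2 ^- k :> R.
Proof. by rewrite eS ltr_pdivrMr// ltr_pMr// ltr1n. Qed.

Let e_le k n : (k <= n)%N -> 2 ^- n <= 2 ^- k :> R.
Proof.
by move=> kn; rewrite lef_pV2 ?posrE ?exprn_gt0// ler_eXn2l ?ltr1n.
Qed.

Let e_le1 k : 2 ^- k <= 1 :> R.
Proof. by rewrite invf_le1 ?exprn_gt0// exprn_ege1 ?ler1n. Qed.

Lemma cusp_pieceE k : Om k = slab `]2 ^- (k + 2), 2 ^- k[.
Proof. by apply/seteqP; split => x; rewrite /slab /cusp_piece /= in_itv. Qed.

Lemma measurable_dyadic_half_open k : measurable (D k).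
Proof. exact: measurable_slab. Qed.

Lemma measurable_dyadic_open k : measurable (B k).
Proof. exact: measurable_slab. Qed.

Lemma dyadic_open_sub_half_open k : B k `<=` D k.
Proof.
move=> x [cx]; rewrite /= in_itv/= => /andP[ax xb]; split => //=.
by rewrite in_itv/= (ltW ax).
Qed.

Lemma dyadic_half_open_sub_piece k : D k `<=` Om k.
Proof.
move=> x [cx]; rewrite /= in_itv/= => /andP[ax xb]; split => //=.
by rewrite xb andbT (lt_le_trans _ ax)// (addn2 k).
Qed.

Lemma dyadic_open_sub_piece k : B k.+1 `<=` Om k.
Proof.
move=> x [cx]; rewrite /= in_itv/= => /andP[ax xb]; split => //=.
by rewrite addn2 ax (lt_trans xb).
Qed.

Lemma trivIset_dyadic : trivIset setT D.
Proof.
apply/trivIsetP => i j _ _; wlog ij : i j / (i < j)%N.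
  move=> h; case: (ltngtP i j) => [ij _|ji _|-> //].
    by apply: h => //; rewrite (ltn_eqF ij).
  by rewrite setIC; apply: h => //; rewrite (ltn_eqF ji).
move=> _; rewrite -subset0 => x [[_ +] [_ +]] /=.
rewrite ?in_itv/= => /andP[ix _] /andP[_ xj].
by move: (lt_le_trans xj (le_trans (e_le ij) ix)); rewrite ltxx.
Qed.

Lemma bigcup_dyadic : \bigcup_k D k = cusp gamma.
Proof.
apply/seteqP; split => [x [k _ []]//|x cx].
have [/andP[x0 x1] _] := cx.
have ex : exists n, 2 ^- n <= x.1.
  have [n] : exists n : nat, x.1^-1 < 2 ^+ n.
    by exists (Num.bound x.1^-1); apply: upper_nthrootP.
  by move=> xn; exists n; rewrite invf_ple ?posrE ?exprn_gt0// ltW.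
(* The least exponent with 2^-n <= x_1 is positive since x_1 < 1; by minimality x_1 lies in the
   slice of the preceding index. *)
case: (ex_minnP ex) => -[|n]; first by rewrite expr0 invr1 leNgt x1.
move=> nx min; exists n => //; split => //=; rewrite in_itv/= nx ltNge /=.
by apply/negP => /min; rewrite ltnn.
Qed.

Definition open_area k := fine (mu (B k)).
Definition piece_area k := fine (mu (Om k)).

Lemma open_areaE k : mu (B k) = (open_area k)%:E.
Proof.
rewrite fineK// ge0_fin_numE// (le_lt_trans (@slab_le 0 1 _ _ _ _ _)) ?ltry//.
move=> x; rewrite /= !in_itv/= => /andP[ax xb].
by rewrite (le_trans (ltW (e_gt0 k.+1)) (ltW ax)) (le_trans (ltW xb) (e_le1 k)).
Qed.

Lemma piece_areaE k : mu (Om k) = (piece_area k)%:E.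
Proof.
rewrite fineK// ge0_fin_numE// cusp_pieceE.
rewrite (le_lt_trans (@slab_le 0 1 _ _ _ _ _)) ?ltry//.
move=> x; rewrite /= !in_itv/= => /andP[ax xb].
by rewrite (le_trans (ltW (e_gt0 _)) (ltW ax)) (le_trans (ltW xb) (e_le1 k)).
Qed.

Lemma open_area_ge k : 2 ^- k.+1 * (2 ^- k.+1) `^ gamma <= open_area k.
Proof.
rewrite -lee_fin -open_areaE.
apply: (le_trans _ (slab_ge (e_gt0 _) (e_lt _) (e_le1 _))).
by rewrite lee_fin eS le_eqVlt; apply/orP; left; apply/eqP; field.
Qed.

Lemma open_area_gt0 k : 0 < open_area k.
Proof. by rewrite (lt_le_trans _ (open_area_ge k))// mulr_gt0 ?powR_gt0. Qed.

Lemma piece_area_gt0 k : 0 < piece_area k.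
Proof.
have : (mu (B k) <= mu (Om k))%E.
  rewrite le_measure ?inE//; [exact: measurable_slab|exact: measurable_cusp_piece|].
  by move=> x /dyadic_open_sub_half_open/dyadic_half_open_sub_piece.
by rewrite open_areaE piece_areaE lee_fin; exact: lt_le_trans (open_area_gt0 k).
Qed.

(** The part of the piece left of [B k] is narrower than [B k], and its height is at most
    (2^-(k+1))^gamma, a lower bound for the height over [B k]. Its area is therefore at most that of
    [B k]. *)
Lemma piece_area_le k : piece_area k <= 2 * open_area k.
Proof.
have sub : Om k `<=` B k `|` slab `[2 ^- k.+2, 2 ^- k.+1].
  move=> x [cx /= /andP[ax xb]]; have [x1|x1] := leP x.1 (2 ^- k.+1).
    by right; split => //=; rewrite in_itv/= x1 andbT -(addn2 k) ltW.
  by left; split => //=; rewrite in_itv/= x1.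
have : (mu (Om k) <= mu (B k) + mu (slab `[2 ^- k.+2, 2 ^- k.+1]))%E.
  apply: le_trans (measureU2 _ _ _); [|exact: measurable_slab..].
  rewrite le_measure ?inE//; first exact: measurable_cusp_piece.
  by apply: measurableU; exact: measurable_slab.
rewrite piece_areaE open_areaE => /le_trans.
move=> /(_ _ (leeD2l _ (@slab_le (2 ^- k.+2) (2 ^- k.+1) _ _ _ _ _))).
rewrite -EFinD lee_fin => /(_ _ (ltW (e_gt0 _)) (ltW (e_lt _)) _).
move=> /(_ (measurable_itv _) (@subset_refl _ _)) h.
apply: (le_trans h); rewrite mulr_natl mulr2n lerD2l (le_trans _ (open_area_ge k))//.
by rewrite ler_wpM2r ?powR_ge0// gerBl ltW.
Qed.

(** An exceptional set that is null for the restricted measure need not be null for [mu], but its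
    intersection with [Om i] is. *)
Lemma ae_mrestrP i (P : plane R -> Prop) :
  (\forall x \ae mrestr mu (measurable_cusp_piece gamma i), P x) ->
  {ae mu, forall x, Om i x -> P x}.
Proof.
move=> [N [mN N0 PN]]; exists (N `&` Om i); split.
- by apply: measurableI => //; exact: measurable_cusp_piece.
- exact: N0.
- move=> x /= /not_implyP[Ox nP]; split => //.
  by apply: PN.
Qed.

(* The only points of [D k.+1] outside [Om k] form the fibre x_1 = 2^-(k+2),
   which is a null set. *)
Lemma dyadic_ae k (P : plane R -> Prop) :
  {ae mu, forall x, Om k x -> P x} -> {ae mu, forall x, D k.+1 x -> P x}.
Proof.
move=> [N [mN N0 PN]]; exists (N `|` slab `[2 ^- k.+2, 2 ^- k.+2]).
have ms : measurable (slab `[2 ^- k.+2, 2 ^- k.+2]) by exact: measurable_slab.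
split; first exact: measurableU.
  apply/eqP; rewrite eq_le measure_ge0 andbT (le_trans (measureU2 _ _ _))//.
  rewrite [X in (X + _)%E]N0 add0e.
  apply: (le_trans (@slab_le (2 ^- k.+2) (2 ^- k.+2) _ (measurable_itv _)
    (ltW (e_gt0 _)) (lexx _) (@subset_refl _ _))).
  by rewrite subrr mul0r.
move=> x /= /not_implyP[[cx]]; rewrite /= in_itv/= => /andP[ax xb] nP.
have [xa|xa] := leP x.1 (2 ^- k.+2).
  by right; split => //=; rewrite in_itv/= ax.
left; apply: PN => /=; apply/not_implyP; split => //; split => //=.
by rewrite addn2 xa (lt_trans xb).
Qed.

(** * Comparison of the weight with its dyadic values *)

Section WeightBounds.
Variables (C : R) (w : R -> R) (omega : plane R -> R).
Hypothesis omega_gt0 : forall x, cusp gamma x -> 0 < omega x.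
Hypothesis adm : forall i,
  (ess_sup_piece gamma i omega <= C%:E * ess_inf_piece gamma i omega)%E.
Hypothesis w_dyadic : essential_dyadic_values gamma w omega.

(** The piece has positive area and omega > 0 on it, so the essential supremum is positive. The
    essential infimum is nonnegative; if it were 0, admissibility would force the supremum to be at
    most 0. It is finite because the real dyadic value of w bounds it from above. *)
Let ess_bounds i : exists2 r : R, 0 < r &
  ess_inf_piece gamma i omega = r%:E /\ (0 < ess_sup_piece gamma i omega)%E.
Proof.
have sup_gt0 : (0 < ess_sup_piece gamma i omega)%E.
  rewrite ltNge; apply/negP => /ess_supP /ae_mrestrP [N [mN N0 PN]].
  have ON : Om i `<=` N.
    move=> x Ox; apply: PN => /= /(_ Ox); rewrite lee_fin leNgt.
    by rewrite omega_gt0//; case: Ox.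
  have : (mu (Om i) <= 0)%E.
    by rewrite -N0 le_measure ?inE//; exact: measurable_cusp_piece.
  rewrite piece_areaE lee_fin leNgt => /negP; apply.
  exact: piece_area_gt0.
have inf_ge0 : (0 <= ess_inf_piece gamma i omega)%E.
  apply/ess_infP; exists (~` Om i); split.
  - by apply: measurableC; exact: measurable_cusp_piece.
  - by rewrite /= /mrestr setICl measure0.
  - move=> x /= nx Ox; apply: nx; rewrite lee_fin ltW// omega_gt0//.
    by case: Ox.
have := w_dyadic i; have := adm i.
case: (ess_inf_piece gamma i omega) inf_ge0 => [r|_|//]; last first.
  by move=> _ /andP[+ _]; rewrite leye_eq.
rewrite lee_fin le_eqVlt => /orP[/eqP <-|r0 _ _]; last by exists r.
by rewrite mule0 leNgt sup_gt0.
Qed.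

(** On [Om 0] one has ess inf <= w(1/2) <= ess sup <= C ess inf, and the essential infimum, positive
    and finite, cancels. *)
Lemma admissible_ge1 : 1 <= C.
Proof.
have [r r0 [rE sup0]] := ess_bounds 0.
have /andP[] := w_dyadic 0; have := adm 0; rewrite rE.
move=> h1 h2 h3; have := le_trans (le_trans h2 h3) h1.
by rewrite -EFinM lee_fin -[leLHS]mul1r ler_pM2r.
Qed.

Lemma weight_dyadic_gt0 i : 0 < w (2 ^- i.+1).
Proof.
have [r r0 [rE _]] := ess_bounds i.
have /andP[+ _] := w_dyadic i; rewrite rE lee_fin.
exact: lt_le_trans.
Qed.

(** The piece [Om i] contains the fibre x_1 = 2^-(i+1) and, up to a null set, the slice [D i.+1]. On
    it omega <= ess sup <= C ess inf <= C w(2^-(i+1)), at the cost of a single factor C. *)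
Lemma weight_le_dyadic i :
  {ae mu, forall x, D i.+1 x -> omega x <= C * w (2 ^- i.+1)}.
Proof.
apply: dyadic_ae; apply: ae_mrestrP; have [r r0 [rE _]] := ess_bounds i.
have /andP[+ _] := w_dyadic i; have := adm i; rewrite rE lee_fin => h1 rw.
have /ess_supP := h1; apply: filterS => x; rewrite lee_fin => /le_trans; apply.
by rewrite ler_wpM2l// (le_trans ler01 admissible_ge1).
Qed.

(** The same chain with the roles exchanged: w(2^-(i+1)) <= ess sup <= C ess inf <= C omega. *)
Lemma weight_ge_dyadic i :
  {ae mu, forall x, D i.+1 x -> w (2 ^- i.+1) <= C * omega x}.
Proof.
apply: dyadic_ae; apply: ae_mrestrP; have [r r0 [rE _]] := ess_bounds i.
have /andP[_ h2] := w_dyadic i; have h1 := adm i; rewrite rE in h1.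
have := le_trans h2 h1; rewrite -EFinM lee_fin => wr.
have /ess_infP : (r%:E <= ess_inf_piece gamma i omega)%E by rewrite rE.
apply: filterS => x; rewrite lee_fin => rx; apply: (le_trans wr).
by rewrite ler_wpM2l// (le_trans ler01 admissible_ge1).
Qed.

End WeightBounds.

(** Test with the sequence that is 1 at j = 1 and 0 elsewhere: the right side is H^p times its term
    j = 1, and the left series contains that same positive term. *)
Lemma hardy_constant_ge1 (p H : R) (w : nat -> R) : 0 < p -> 0 <= H -> 0 < w 1%N ->
  hardy_inequality gamma p H w -> 1 <= H.
Proof.
move=> p0 H0 w0 /(_ (fun j => (j == 1)%:R)) /(_ (fun j _ => ler0n _ _)).
have a0 := piece_area_gt0 1.
set u := fun j => (mu (Om j) *
  (w j `^ p * (\sum_(1 <= i < j.+1) (i == 1)%:R) `^ p)%:E)%E.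
set v := fun j => (mu (Om j) * (w j `^ p * (j == 1)%:R `^ p)%:E)%E.
have E1 : u 1%N = (piece_area 1 * w 1%N `^ p)%:E.
  by rewrite /u big_nat1 eqxx powR1 mulr1 piece_areaE -EFinM.
have Ev : (\sum_(1 <= j <oo) v j = (piece_area 1 * w 1%N `^ p)%:E)%E.
  rewrite (nneseries_split _ 1); last first.
    by move=> j _; rewrite mule_ge0// lee_fin mulr_ge0 ?powR_ge0.
  rewrite big_nat1 eseries0 ?adde0.
    by rewrite /v eqxx powR1 mulr1 piece_areaE -EFinM.
  move=> j j1 _; rewrite /v gtn_eqF//.
  by rewrite powR0 ?mulr0 ?mule0// gt_eqF.
rewrite [X in (_ <= _ * X)%E -> _]Ev.
move=> /(le_trans (@nneseries_lim_ge _ u xpredT 1 2 _)).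
rewrite big_nat1 E1 -EFinM lee_fin.
have c0 : 0 < piece_area 1 * w 1%N `^ p by rewrite mulr_gt0 ?powR_gt0.
move=> /(_ _) h; have {h} : 1 <= H `^ p.
  rewrite -(ler_pM2r c0) mul1r; apply: h => j _ _.
  by rewrite mule_ge0// lee_fin mulr_ge0 ?powR_ge0.
rewrite leNgt => Hp; rewrite leNgt; apply: contra Hp => H1.
by move: (@gt0_ltr_powR _ p p0 H 1); rewrite !nnegrE powR1 => ->.
Qed.

End CuspGeometry.

(** * Application of the abstract decomposition to the cusp *)

Theorem theorem2p5 (R : realType) (gamma p q : R)
  (gamma_ge1 : 1 <= gamma) (p_gt1 : 1 < p) (q_gt1 : 1 < q)
  (pq : p^-1 + q^-1 = 1)
  (omega : plane R -> R) (w : R -> R) (Comega CH : R)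
  (omega_weight : weight gamma omega)
  (omegaE : forall x, cusp gamma x -> omega x = w x.1)
  (omega_adm : admissible gamma p Comega omega)
  (w_dyadic : essential_dyadic_values gamma w omega)
  (CH_ge0 : 0 <= CH)
  (hardy : hardy_inequality gamma p CH (fun i => w (2 ^- i))) :
  (exists Cd, decomposition_constant gamma q omega Cd) /\
  optimal_decomposition_constant gamma q omega
    <= 2 `^ (2 + q^-1) * Comega ^+ 2 * CH.
Proof.
have gamma0 : 0 <= gamma by exact: le_trans gamma_ge1.
have [momega omega_gt0] := omega_weight; have [_ adm] := omega_adm.
have C1 := admissible_ge1 gamma0 omega_gt0 adm w_dyadic.
have w_gt0 := weight_dyadic_gt0 gamma0 omega_gt0 adm w_dyadic.
have H1 : 1 <= CH.
  exact: (hardy_constant_ge1 gamma0 (lt_trans ltr01 p_gt1) CH_ge0 (w_gt0 0) hardy).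
(* One explicit constant settles both claims: it witnesses existence, and it bounds the infimum, the
   set of constants being bounded below by 0. *)
suff dc : decomposition_constant gamma q omega
    (2 `^ (2 + q^-1) * Comega ^+ 2 * CH).
  split; first by eexists; exact: dc.
  by apply: ge_inf => //; exists 0 => Cd [].
split; first by rewrite !mulr_ge0 ?powR_ge0 ?exprn_ge0// (le_trans ler01 C1).
move=> g ig g0.
have cuspE := bigcup_dyadic gamma.
have mD := measurable_dyadic_half_open gamma.
have mB := measurable_dyadic_open gamma.
have mOm := measurable_cusp_piece gamma.
have BD := @dyadic_open_sub_half_open R gamma.
have DO := @dyadic_half_open_sub_piece R gamma.
have BO := @dyadic_open_sub_piece R gamma.
have tD := @trivIset_dyadic R gamma.
have muB := open_areaE gamma0; have muO := piece_areaE gamma0.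
have b_gt0 := open_area_gt0 gamma0.
have m_le := piece_area_le gamma0.
have OX k : cusp_piece gamma k `<=` \bigcup_k dyadic_half_open gamma k.
  by rewrite cuspE => x [].
have DOX k : dyadic_half_open gamma k `<=` \bigcup_k dyadic_half_open gamma k.
  by move=> x Dx; exists k.
have wk_gt0 k : (1 <= k)%N -> 0 < w (2 ^- k) by case: k.
(* The weight bounds are indexed by the piece k - 1, hence the restriction to k >= 1. *)
have w_le k : (1 <= k)%N -> {ae plane_measure R, forall x,
    dyadic_half_open gamma k x -> omega x <= Comega * w (2 ^- k)}.
  by case: k => // k _; exact: (weight_le_dyadic gamma0 omega_gt0 adm w_dyadic).
have w_ge k : (1 <= k)%N -> {ae plane_measure R, forall x,
    dyadic_half_open gamma k x -> w (2 ^- k) <= Comega * omega x}.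
  by case: k => // k _; exact: (weight_ge_dyadic gamma0 omega_gt0 adm w_dyadic).
have hardy' (d : nat -> R) : (forall j, (1 <= j)%N -> 0 <= d j) ->
  (\sum_(1 <= j <oo) ((piece_area gamma j)%:E *
     (w (2 ^- j) `^ p * (\sum_(1 <= i < j.+1) d i) `^ p)%:E)
   <= (CH `^ p)%:E *
      \sum_(1 <= j <oo) ((piece_area gamma j)%:E *
        (w (2 ^- j) `^ p * d j `^ p)%:E))%E.
  move=> /hardy; under eq_eseriesr do rewrite muO.
  by under [X in (_ <= _ * X)%E -> _]eq_eseriesr do rewrite muO.
rewrite -cuspE in momega omega_gt0 ig g0 *.
exists (orth_piece (@plane_measure R) (dyadic_half_open gamma) (dyadic_open gamma) g
  (open_area gamma)).
  split; rewrite -?cuspE.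
  (* The domain is the union of all slices here, for integrability on the cusp, and [Om k] for the
     mean-zero condition below. *)
  - move=> k; apply: (orth_piece_mean0 mD tD mB BD muB b_gt0 ig _ (@DOX k) _ _).1 => //.
      exact: bigcup_measurable.
    exact: subset_trans (@BD k.+1) (@DOX k.+1).
  - move=> x; exact: (series_orth_piece (open_area gamma) tD BD g0).
  - by move=> k x; exact: (orth_piece_support BD DO BO).
  - move=> k.
    exact: (orth_piece_mean0 mD tD mB BD muB b_gt0 ig (mOm k)
      (@DO k) (@BO k) (@OX k)).2.
exact: (energy_le p_gt1 q_gt1 pq mD tD mB mOm BD DO BO OX muB b_gt0 muO m_le C1 H1
  wk_gt0 momega omega_gt0 w_le w_ge hardy' ig g0).
Qed.
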